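(* Let $d\ge 2$ be an integer. For every positive integer $q$ there exists a positive constant $B_q$ depending on $d$ and $q$ only such that the following holds. Let $n\ge 1$ be an integer, let $K$ be a convex body in $\mathbb R^d$ with $K\subseteq B_d$, let $f$ be a probability density (with respect to Lebesgue measure) supported on $K$ with $f\le M$ almost everywhere for some positive number $M$, let $X_1,\dots,X_n$ be i.i.d. random points with density $f$, and let $R_n$ be the number of vertices of their convex hull $\hat K_n$. Then $$\mathbb E_f\left[R_n^q\right]\le B_q(M+1)^q n^{\frac{q(d-1)}{d+1}}.$$
   Context: A convex body in $\mathbb R^d$ is a compact convex set with nonempty interior. $B_d$ is the closed unit Euclidean ball of $\mathbb R^d$ centered at $0$. $\mathbb E_f$ denotes expectation when $X_1,\dots,X_n$ are i.i.d. with density $f$. That $f$ is supported on $K$ means that $f=0$ outside $K$. *)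

(* Defs.v *)
From HB Require Import structures.
From mathcomp Require Import all_boot all_order all_algebra.
From mathcomp Require Import finmap.
From mathcomp Require Import all_classical all_reals all_analysis.

Set Implicit Arguments.
Unset Strict Implicit.
Unset Printing Implicit Defensive.

Import Order.TTheory GRing.Theory Num.Theory.
Import numFieldNormedType.Exports.

Local Open Scope classical_set_scope.
Local Open Scope ring_scope.

(* The product sigma-algebra on row vectors, generated by the coordinates
   (as the library does for [n.-tuple T]); on ['rV[R]_d] it is the Borel one. *)
Definition measure_row_display : measure_display -> measure_display.
Proof. exact. Qed.

Section measurable_row.
Context {disp} {T : measurableType disp} (n : nat).

Let coor : 'I_n -> 'rV[T]_n -> T := fun i x => x ord0 i.

Let row_set0 : g_sigma_preimage coor set0.
Proof. exact: sigma_algebra0. Qed.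

Let row_setC A : g_sigma_preimage coor A -> g_sigma_preimage coor (~` A).
Proof. exact: sigma_algebraC. Qed.

Let row_bigcup (F : (set 'rV[T]_n)^nat) :
  (forall i, g_sigma_preimage coor (F i)) ->
  g_sigma_preimage coor (\bigcup_i F i).
Proof. exact: sigma_algebra_bigcup. Qed.

HB.instance Definition _ := @isMeasurable.Build (measure_row_display disp)
  'rV[T]_n (g_sigma_preimage coor) row_set0 row_setC row_bigcup.

End measurable_row.

Lemma measurable_coord disp (T : measurableType disp) n (i : 'I_n) :
  measurable_fun [set: 'rV[T]_n] (fun x : 'rV[T]_n => x ord0 i).
Proof.
move=> _ Y mY; rewrite setTI; apply: sub_sigma_algebra => /=.
rewrite -bigcup_seq/=; exists i => /=; first by rewrite mem_index_enum.
by exists Y => //; rewrite setTI.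
Qed.

Lemma measurable_fun_row disp1 disp2 (T1 : measurableType disp1)
    (T2 : measurableType disp2) n (f : T1 -> 'rV[T2]_n) :
  (forall i, measurable_fun [set: T1] (fun x => f x ord0 i)) ->
  measurable_fun [set: T1] f.
Proof.
move=> mf _ A mA; rewrite setTI.
suff H : g_sigma_preimage (fun (i : 'I_n) (x : 'rV[T2]_n) => x ord0 i) `<=`
    [set B | measurable (f @^-1` B)] by exact: H.
apply: smallest_sub.
  split; rewrite /=.
  - by rewrite preimage_set0.
  - by move=> B mB; rewrite setTD preimage_setC; exact: measurableC.
  - by move=> F mF; rewrite preimage_bigcup; exact: bigcupT_measurable.
rewrite -bigcup_seq => B [i _ [C mC <-]].
by rewrite /= setTI; have := mf i measurableT C mC; rewrite setTI.
Qed.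

Section lebesgue_row.
Variable R : realType.

Definition consrow n (p : 'rV[R]_n * measurableTypeR R) : 'rV[R]_n.+1 :=
  \row_(i < n.+1) if unlift ord0 i is Some j then p.1 ord0 j else p.2.

Lemma measurable_consrow n : measurable_fun setT (@consrow n).
Proof.
apply: measurable_fun_row => i.
case: (unliftP ord0 i) => [j|] ->.
- rewrite (_ : (fun _ => _) = (fun x : 'rV[R]_n => x ord0 j) \o fst); last first.
    by apply/funext => p /=; rewrite mxE liftK.
  by apply: measurableT_comp => //; exact: measurable_coord.
- rewrite (_ : (fun _ => _) = snd).
    exact: (@measurable_snd _ _ 'rV[R]_n (measurableTypeR R)).
  by apply/funext => p /=; rewrite mxE unlift_none.
Qed.

Definition lebesgue_succ n (mu : {measure set 'rV[R]_n -> \bar R}) :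
    set 'rV[R]_n.+1 -> \bar R :=
  pushforward (mu \x @lebesgue_measure R)%E (@consrow n).

Section lebesgue_succ_measure.
Variables (n : nat) (mu : {measure set 'rV[R]_n -> \bar R}).

Let lebesgue_succ0 : lebesgue_succ mu set0 = 0%E.
Proof. by rewrite /lebesgue_succ /pushforward preimage_set0 measure0. Qed.

Let lebesgue_succ_ge0 A : (0 <= lebesgue_succ mu A)%E.
Proof. exact: (measure_ge0 (mu \x @lebesgue_measure R)%E). Qed.

Let lebesgue_succ_sigma_additive : semi_sigma_additive (lebesgue_succ mu).
Proof.
have mf A : measurable A -> measurable (@consrow n @^-1` A).
  by move=> mA; rewrite -[X in measurable X]setTI; exact: measurable_consrow.
move=> F mF tF mUF; rewrite /lebesgue_succ /pushforward preimage_bigcup.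
apply: measure_semi_sigma_additive.
- by move=> k; exact: mf.
- move=> i j _ _ [p [pi pj]]; apply: tF => //.
  by exists (consrow p); split.
- by rewrite -preimage_bigcup; exact: mf.
Qed.

HB.instance Definition _ := isMeasure.Build _ _ _ (lebesgue_succ mu)
  lebesgue_succ0 lebesgue_succ_ge0 lebesgue_succ_sigma_additive.

End lebesgue_succ_measure.

(* Lebesgue measure on R^d: the d-fold product of the one-dimensional one,
   transported from R^(d-1) x R to R^d. *)
Fixpoint lebesgue_row (d : nat) : {measure set 'rV[R]_d -> \bar R} :=
  if d is n.+1 then lebesgue_succ (lebesgue_row n) else \d_(0 : 'rV[R]_0).

Lemma lebesgue_row_box d (A : 'I_d -> set R) :
  (forall i, measurable (A i)) ->
  lebesgue_row d [set x | forall i, A i (x ord0 i)] =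
  (\prod_(i < d) lebesgue_measure (A i))%E.
Proof.
elim: d A => [|d IH] A mA.
  by rewrite big_ord0 /= diracE mem_set// => -[].
rewrite big_ord_recl muleC -IH// /= /lebesgue_succ /pushforward.
rewrite (_ : _ @^-1` _ =
  [set x : 'rV[R]_d | forall i, A (lift ord0 i) (x ord0 i)] `*` A ord0).
  apply: product_measure1E; last exact: (mA ord0).
  rewrite (_ : mkset _ = \bigcap_(i : 'I_d)
      (fun x : 'rV[R]_d => x ord0 i) @^-1` A (lift ord0 i)).
    apply: fin_bigcap_measurable => // i _.
    by rewrite -[X in measurable X]setTI; exact: measurable_coord.
  by apply/seteqP; split=> x /= H i; [move=> _|]; exact: H.
apply/seteqP; split=> [[x r]|[x r] []] /=.
  move=> H; split=> [i|].
    by have := H (lift ord0 i); rewrite mxE liftK.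
  by have := H ord0; rewrite mxE unlift_none.
move=> Hx Hr i; rewrite mxE; case: unliftP => [j|] -> //; exact: Hx.
Qed.

End lebesgue_row.

Section convex_geometry.
Variables (R : realType) (d : nat).
Implicit Types A K : set 'rV[R]_d.

Definition euclidean_norm (x : 'rV[R]_d) : R :=
  Num.sqrt (\sum_(i < d) x ord0 i ^+ 2).

(* [closed_ball] of the library is taken for the sup norm on row vectors. *)
Definition unit_euclidean_ball : set 'rV[R]_d :=
  [set x | euclidean_norm x <= 1].

Definition convex_body K := [/\ compact K, convex_set K & K° !=set0].

Definition convex_hull A : set 'rV[R]_d := smallest (@convex_set R 'rV[R]_d) A.

Definition extreme_points A : set 'rV[R]_d :=
  [set x | A x /\ forall (y z : 'rV[R]_d) (t : R),
     A y -> A z -> 0 < t < 1 -> x = t *: y + (1 - t) *: z -> y = x /\ z = x].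

(* The vertices of a polytope are its extreme points. [fset_set] sends
   infinite sets to the empty one, which does not happen here by
   [finite_extreme_points]. *)
Definition vertex_number n (x : 'I_n -> 'rV[R]_d) : nat :=
  #|` fset_set (extreme_points (convex_hull (range x)))|.

Lemma extreme_points_convex_hull A :
  extreme_points (convex_hull A) `<=` A.
Proof.
move=> x [hx ext]; apply: contrapT => nAx.
have cvx : convex_set (convex_hull A : set (convex_lmodType 'rV[R]_d)).
  move=> y z l /set_mem hy /set_mem hz; apply/mem_set => B [cB AB].
  by apply/set_mem/cB; apply/mem_set; [exact: hy|exact: hz].
have : (convex_hull A `\ x) x.
  apply: hx; split; last first.
    by move=> y Ay; split; [move=> B [_]; exact|move=> /= yx; apply: nAx; rewrite -yx].
  apply/convex_setW => y z /set_mem[hy nyx] /set_mem[hz nzx] k k0 k1.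
  apply/mem_set; split; first by apply/set_mem/cvx; exact/mem_set.
  move=> /= kx; have [yx _] : y = x /\ z = x.
    by apply: (ext y z k%:num) => //; rewrite ?k0 ?k1// -kx.
  exact: nyx.
by case=> _; exact.
Qed.

Lemma finite_extreme_points n (x : 'I_n -> 'rV[R]_d) :
  finite_set (extreme_points (convex_hull (range x))).
Proof.
apply: sub_finite_set (@extreme_points_convex_hull _) _.
exact/finite_image/finite_finset.
Qed.

End convex_geometry.

Arguments unit_euclidean_ball : clear implicits.

Section random_points.
Context {disp disp'} {T : measurableType disp} {E : measurableType disp'}.
Context {R : realType} (P : probability T R).

Definition mutually_independent n (X : 'I_n -> {RV P >-> E}) :=
  forall (J : {set 'I_n}) (A : 'I_n -> set E), (forall i, measurable (A i)) ->
  P (\bigcap_(i in [set` J]) X i @^-1` A i) =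
  (\prod_(i in J) P (X i @^-1` A i))%E.

End random_points.

Section densities.
Variables (R : realType) (d : nat).

Definition probability_density (f : 'rV[R]_d -> R) :=
  [/\ measurable_fun setT f, (forall x, 0 <= f x) &
      (\int[lebesgue_row R d]_x (f x)%:E = 1)%E].

Definition has_density disp (T : measurableType disp) (P : probability T R)
    (X : {RV P >-> 'rV[R]_d}) (f : 'rV[R]_d -> R) :=
  forall A, measurable A ->
  distribution P X A = (\int[lebesgue_row R d]_(x in A) (f x)%:E)%E.

End densities.

(* Main.v *)
Require Import Defs.
From HB Require Import structures.
From mathcomp Require Import all_boot all_order all_algebra finmap.
From mathcomp Require Import all_classical all_reals all_analysis.
From mathcomp Require Import measurable_realfun ring lra.
Import Order.TTheory GRing.Theory Num.Theory.
Import numFieldNormedType.Exports.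
Local Open Scope classical_set_scope.
Local Open Scope ring_scope.

Set Implicit Arguments.
Unset Strict Implicit.
Unset Printing Implicit Defensive.

(** Let [C] be the hull of the points and let the resolution be [eps = 2 ^ - l],
    with [l] minimal such that [n <= 2 ^ (l (d + 1))]; then
    [N = 2 ^ (l (d - 1))] is of order [n ^ ((d - 1) / (d + 1))] and a set of
    volume [eps ^ (d + 1)] has mass of order [M / n].

    Everything is seen from the boundary of the cube of half-side 3. From a point
    [y] of this boundary one records the projection [p] of [y] onto [C] and the
    number [phi y], the maximum over [x] in [C] of [<x, y> - |x| ^ 2 / 2], which
    is attained at [p]. The function [phi] is convex with gradient [p], and [p]
    is 1-Lipschitz in [y] ([proj_nonexpansive], [proj_taylor]). A vertex [x] of
    [C] has an outer normal, and [x] is the projection of the point [y] at which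
    the ray issued from [x] along the normal meets the cube boundary
    ([extreme_point_normal], [ray_hits_face]). If [z] is a point of an
    [eps]-net of the cube boundary close to [y], then the smoothness of [phi]
    puts [x] in a plate attached to [z]: within [O(eps)] of the projection of
    [z], and within [O(eps ^ 2)] of a sphere centred at [z]
    ([extreme_point_in_plate]). A plate has volume [O(eps ^ (d + 1))], and the
    net has [O(N)] points, so all the vertices lie in a set of volume
    [O(N eps ^ (d + 1)) = O(eps ^ 2)], which depends on [C].

    The main point is that only [exp (O(N))] such sets are needed, without the
    logarithm that separate roundings of the plates would cost ([jet_entropy]).
    The pairs [(phi, p)] are recorded on nets of resolutions [1], [1/2], ...,
    [2 ^ - l]. Taylor expansion from the parent node predicts the value at a node
    of the next net with an error comparable to the precision wanted there, so
    that a bounded number of bits per node corrects it, and the numbers of nodes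
    form a geometric series with sum [O(N)].

    For one fixed set [A] of the family ([cap_cover]), of mass [p], the number [k]
    of sample points in [A] satisfies [E 2 ^ k <= (1 + p) ^ n <= exp (n p)], and
    [n p = O(M N)] ([expectation_exp2_hits]). Summing over the family, the number
    [V] of vertices satisfies [E 2 ^ V <= exp L] with [L = O((M + 1) N)], and
    hence its moment of order [q] is [O(L ^ q)] ([moment_bound]). *)

(** * Projection onto the hull of a finite family *)

Section euclidean.
Variables (R : realType) (d : nat).
Implicit Types (u v x y z : 'rV[R]_d).

Definition dotp u v : R := \sum_k u ord0 k * v ord0 k.
Definition nsq u : R := dotp u u.

Lemma dotpC u v : dotp u v = dotp v u.
Proof. by apply: eq_bigr => k _; rewrite mulrC. Qed.

Lemma dotpDl u v w : dotp (u + v) w = dotp u w + dotp v w.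
Proof. by rewrite -big_split; apply: eq_bigr => k _; rewrite mxE mulrDl. Qed.

Lemma dotpZl a u v : dotp (a *: u) v = a * dotp u v.
Proof. by rewrite /dotp mulr_sumr; apply: eq_bigr => k _; rewrite mxE mulrA. Qed.

Lemma dotpNl u v : dotp (- u) v = - dotp u v.
Proof. by rewrite -scaleN1r dotpZl mulN1r. Qed.

Lemma dotpDr u v w : dotp w (u + v) = dotp w u + dotp w v.
Proof. by rewrite !(dotpC w) dotpDl. Qed.

Lemma dotpZr a u v : dotp v (a *: u) = a * dotp v u.
Proof. by rewrite !(dotpC v) dotpZl. Qed.

Lemma dotpNr u v : dotp v (- u) = - dotp v u.
Proof. by rewrite !(dotpC v) dotpNl. Qed.

Definition dotpE := (dotpDl, dotpDr, dotpNl, dotpNr, dotpZl, dotpZr).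

Lemma dotp0l u : dotp 0 u = 0.
Proof. by rewrite -(scale0r u) dotpZl mul0r. Qed.

Lemma dotp_suml I (r : seq I) (P : pred I) (F : I -> 'rV[R]_d) u :
  dotp (\sum_(i <- r | P i) F i) u = \sum_(i <- r | P i) dotp (F i) u.
Proof.
elim/big_rec2: _ => [|i a b _ <-]; [exact: dotp0l|exact: dotpDl].
Qed.

Lemma nsq_ge0 u : 0 <= nsq u.
Proof. by apply: sumr_ge0 => k _; rewrite -expr2 sqr_ge0. Qed.

Lemma coord_le_nsq u k : u ord0 k ^+ 2 <= nsq u.
Proof.
rewrite /nsq /dotp (bigD1 k)//= -expr2 lerDl.
by apply: sumr_ge0 => i _; rewrite -expr2 sqr_ge0.
Qed.

Lemma nsq_eq0 u : nsq u = 0 -> u = 0.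
Proof.
move=> u0; apply/rowP => k; rewrite mxE; apply/eqP; rewrite -sqrf_eq0.
by rewrite eq_le sqr_ge0 andbT -u0 coord_le_nsq.
Qed.

Lemma dotp_le u v : dotp u v <= (nsq u + nsq v) / 2.
Proof. have := nsq_ge0 (u - v); rewrite /nsq !dotpE (dotpC v u); lra. Qed.

Lemma ler_norm_coord u k (c r : R) : 0 <= c -> 1 <= r -> nsq u <= r * c ^+ 2 ->
  `|u ord0 k| <= r * c.
Proof.
move=> c0 r1 /(le_trans (coord_le_nsq u k)) h.
rewrite -(@ler_pXn2r _ 2)// ?nnegrE//; last by rewrite mulr_ge0// (le_trans _ r1).
rewrite real_normK ?num_real// (le_trans h)// exprMn ler_wpM2r ?sqr_ge0//.
by rewrite expr2 ler_peMr// (le_trans _ r1).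
Qed.

Lemma le_nsq u (c : R) : (forall k, `|u ord0 k| <= c) -> nsq u <= d%:R * c ^+ 2.
Proof.
move=> h; rewrite mulr_natl -[X in _ *+ X]card_ord -sumr_const ler_sum// => k _.
by rewrite -expr2 -real_normK ?num_real// ler_sqr ?nnegrE// (le_trans _ (h k)).
Qed.

Lemma ler_norm_dotp u v (a b : R) : (forall k, `|u ord0 k| <= a) ->
  (forall k, `|v ord0 k| <= b) -> `|dotp u v| <= d%:R * (a * b).
Proof.
move=> hu hv; rewrite mulr_natl -[X in _ *+ X]card_ord -sumr_const.
rewrite (le_trans (ler_norm_sum _ _ _))// ler_sum// => k _.
by rewrite normrM ler_pM.
Qed.

(** [obs y x] is [(nsq y - nsq (y - x)) / 2]: maximising it in [x] amounts to
    projecting [y], and the additive constant that is dropped makes the maximum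
    a convex function of [y] whose gradient is the projection. *)
Definition obs y x : R := dotp x y - nsq x / 2.

Lemma obsB y x z : obs y x - obs y z = dotp (x - z) (y - z) - nsq (x - z) / 2.
Proof. by rewrite /obs /nsq !dotpE (dotpC z x); lra. Qed.

Lemma obsBy y z x : obs y x - obs z x = dotp x (y - z).
Proof. by rewrite /obs !dotpE; lra. Qed.

End euclidean.

Section hull.
Variables (R : realType) (d n : nat).
Implicit Types (X Y : 'I_n -> 'rV[R]_d).

Definition simplex : set 'rV[R]_n :=
  [set w | (forall j, 0 <= w ord0 j) /\ \sum_j w ord0 j = 1].

Definition barycenter X (w : 'rV[R]_n) : 'rV[R]_d := \sum_j w ord0 j *: X j.

Lemma barycenterE X w k : barycenter X w ord0 k = \sum_j w ord0 j * X j ord0 k.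
Proof. by rewrite summxE; apply: eq_bigr => j _; rewrite mxE. Qed.

Lemma barycenter_delta X j : barycenter X (delta_mx ord0 j) = X j.
Proof.
rewrite /barycenter (bigD1 j)//= mxE !eqxx scale1r big1 ?addr0// => i ij.
by rewrite mxE eqxx (negbTE ij) scale0r.
Qed.

Lemma simplex_delta j : simplex (delta_mx ord0 j).
Proof.
split=> [i|]; first by rewrite mxE ler0n.
rewrite (bigD1 j)//= mxE !eqxx big1 ?addr0// => i ij.
by rewrite mxE eqxx (negbTE ij).
Qed.

Lemma simplex_convex w1 w2 (s : R) : 0 <= s <= 1 -> simplex w1 -> simplex w2 ->
  simplex ((1 - s) *: w1 + s *: w2).
Proof.
move=> /andP[s0 s1] [w10 w11] [w20 w21]; split=> [j|].
  by rewrite !mxE addr_ge0// mulr_ge0// subr_ge0.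
under eq_bigr do rewrite !mxE.
by rewrite big_split/= -!big_distrr/= w11 w21; lra.
Qed.

Lemma barycenterD X w1 w2 (s t : R) :
  barycenter X (s *: w1 + t *: w2) = s *: barycenter X w1 + t *: barycenter X w2.
Proof.
rewrite /barycenter !scaler_sumr -big_split; apply: eq_bigr => j _ /=.
by rewrite !mxE scalerDl !scalerA.
Qed.

Lemma dotp_barycenter_le X w u (c : R) : simplex w ->
  (forall j, dotp (X j) u <= c) -> dotp (barycenter X w) u <= c.
Proof.
move=> [w0 w1] h; rewrite dotp_suml -[leRHS]mul1r -w1 big_distrl ler_sum//= => j _.
by rewrite dotpZl ler_wpM2l.
Qed.

Lemma barycenter_box X w (c : R) k : simplex w ->
  (forall j, `|X j ord0 k| <= c) -> `|barycenter X w ord0 k| <= c.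
Proof.
move=> [w0 w1] h; rewrite barycenterE (le_trans (ler_norm_sum _ _ _))//.
rewrite -[leRHS]mul1r -w1 big_distrl ler_sum//= => j _.
by rewrite normrM (ger0_norm (w0 j)) ler_wpM2l.
Qed.

Lemma continuous_coord (m : nat) k : continuous (fun w : 'rV[R]_m => w ord0 k).
Proof. by move=> w; exact: coord_continuous. Qed.

Lemma continuous_sumr (T : topologicalType) (I : finType) (F : I -> T -> R) :
  (forall i, continuous (F i)) -> continuous (fun x => \sum_i F i x).
Proof. by move=> h; apply: continuous_big => // x; exact: add_continuous. Qed.

Lemma simplex_compact : compact simplex.
Proof.
have cube : compact [set w : 'rV[R]_n | forall j, `[0, 1]%classic (w ord0 j)].
  apply: (@rV_compact R n (fun=> `[0, 1]%classic)) => _.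
  exact: segment_compact.
apply: subclosed_compact cube _.
- rewrite (_ : simplex = (\bigcap_j [set w | 0 <= w ord0 j]) `&`
     [set w | \sum_j w ord0 j = 1]); last first.
    by apply/seteqP; split=> w [h1 h2]; split=> // j; [move=> _|]; exact: h1.
  apply: closedI.
  + apply: closed_bigI => j _.
    have /continuous_closedP h := @continuous_coord n j.
    exact: h _ (@closed_ge R 0).
  + have /continuous_closedP h : continuous (fun w : 'rV[R]_n => \sum_j w ord0 j).
      by apply: continuous_sumr => j; exact: continuous_coord.
    exact: h _ (@closed_eq R 1).
- move=> w [w0 w1] j /=; rewrite in_itv/= w0 -w1 (bigD1 j)//= lerDl.
  exact: sumr_ge0.
Qed.

Lemma continuous_obs_barycenter X y :
  continuous (fun w : 'rV[R]_n => obs y (barycenter X w)).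
Proof.
have cM (f g : 'rV[R]_n -> R) : continuous f -> continuous g ->
    continuous (fun x => f x * g x).
  by move=> cf cg x; apply: continuousM; [exact: cf|exact: cg].
have cB (f g : 'rV[R]_n -> R) : continuous f -> continuous g ->
    continuous (fun x => f x - g x).
  by move=> cf cg x; apply: continuousB; [exact: cf|exact: cg].
have cst (c : R) : continuous (fun _ : 'rV[R]_n => c).
  exact: cst_continuous.
have cb k : continuous (fun w : 'rV[R]_n => barycenter X w ord0 k).
  rewrite (_ : (fun _ => _) = fun w : 'rV[R]_n => \sum_j w ord0 j * X j ord0 k).
    apply: continuous_sumr => j; apply: cM => //; exact: continuous_coord.
  by apply/funext => w; rewrite barycenterE.
have c1 : continuous (fun w : 'rV[R]_n => dotp (barycenter X w) y).
  by apply: continuous_sumr => k; exact: cM.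
have c2 : continuous (fun w : 'rV[R]_n => nsq (barycenter X w) / 2).
  by apply: (cM) => //; apply: continuous_sumr => k; exact: cM.
exact: (cB _ _ c1 c2).
Qed.

Definition bary_hull X : set 'rV[R]_d := barycenter X @` simplex.

Lemma bary_hull_family X j : bary_hull X (X j).
Proof.
exists (delta_mx ord0 j); [exact: simplex_delta|exact: barycenter_delta].
Qed.

Lemma bary_hull_convex X x z (s : R) : 0 <= s <= 1 -> bary_hull X x ->
  bary_hull X z -> bary_hull X (x + s *: (z - x)).
Proof.
move=> s01 [w1 hw1 <-] [w2 hw2 <-]; exists ((1 - s) *: w1 + s *: w2).
  exact: simplex_convex.
by rewrite barycenterD scalerBl scale1r scalerBr -!addrA (addrC (- _)).
Qed.

(** The metric projection of [y] onto the hull of the family. *)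
Definition is_proj X y p :=
  bary_hull X p /\ forall x, bary_hull X x -> obs y x <= obs y p.

Lemma exists_proj X y : (0 < n)%N -> exists p, is_proj X y p.
Proof.
move=> n0.
have [|w /set_mem sw hw] := compact_EVT_max (f := fun w => obs y (barycenter X w))
    _ simplex_compact (continuous_subspaceT (@continuous_obs_barycenter X y)).
  by exists (delta_mx ord0 (Ordinal n0)); exact: simplex_delta.
exists (barycenter X w); split; first by exists w.
by move=> _ [w' sw' <-]; apply: hw; exact/mem_set.
Qed.

(** The variational inequality of the projection onto a convex set: otherwise
    a small step from [p] towards [z] would increase [obs y]. *)
Lemma proj_obtuse X y p z : is_proj X y p -> bary_hull X z ->
  dotp (z - p) (y - p) <= 0.
Proof.
move=> [Cp hp] Cz; rewrite leNgt; apply/negP => pos.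
set c := dotp _ _ in pos; set D := nsq (z - p).
have D0 : 0 <= D := nsq_ge0 _.
have step (s : R) : 0 <= s <= 1 -> s * c <= s ^+ 2 * D / 2.
  move=> s01; have := hp _ (bary_hull_convex s01 Cp Cz).
  rewrite -subr_le0 obsB (addrC p) addrK dotpZl {1}/nsq dotpZl dotpZr -/c -/(nsq _) -/D.
  by rewrite expr2; lra.
have cD : 0 < c + D by rewrite ltr_wpDr.
have s01 : 0 <= c / (c + D) <= 1.
  apply/andP; split; first by rewrite divr_ge0// ltW.
  by rewrite ler_pdivrMr// mul1r lerDl.
have sE : c / (c + D) * (c + D) = c by rewrite divfK// gt_eqF.
have s0 : 0 < c / (c + D) by rewrite divr_gt0.
have := step _ s01; move: sE s0; move: (c / (c + D)) => s sE s0.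
rewrite expr2 -!mulrA ler_pM2l// leNgt => /negP; apply.
have := mulr_gt0 s0 pos; move: sE; rewrite mulrDr; lra.
Qed.

Lemma proj_firmly_nonexpansive X y1 y2 p1 p2 : is_proj X y1 p1 ->
  is_proj X y2 p2 -> nsq (p2 - p1) <= dotp (p2 - p1) (y2 - y1).
Proof.
move=> h1 h2; have := proj_obtuse h1 h2.1; have := proj_obtuse h2 h1.1.
rewrite /nsq !dotpE (dotpC p1 p2); lra.
Qed.

Lemma proj_nonexpansive X y1 y2 p1 p2 : is_proj X y1 p1 -> is_proj X y2 p2 ->
  nsq (p2 - p1) <= nsq (y2 - y1).
Proof.
move=> h1 h2; have := proj_firmly_nonexpansive h1 h2.
have := dotp_le (p2 - p1) (y2 - y1); lra.
Qed.

(** The maximum of [obs y] over the hull is a convex function of [y] with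
    Lipschitz gradient [p]. *)
Lemma proj_taylor X y1 y2 p1 p2 : is_proj X y1 p1 -> is_proj X y2 p2 ->
  0 <= obs y2 p2 - obs y1 p1 - dotp p1 (y2 - y1) <= nsq (y2 - y1).
Proof.
move=> h1 h2; have := h2.2 _ h1.1; have := h1.2 _ h2.1.
have := obsBy y2 y1 p1; have := obsBy y2 y1 p2.
have := proj_nonexpansive h1 h2; have := dotp_le (p2 - p1) (y2 - y1).
rewrite dotpDl dotpNl; set a := dotp p2 _; set b := dotp p1 _.
move=> *; apply/andP; split; lra.
Qed.

(** On the hull, [obs (x + u)] is below its value at [x] by at least half the
    squared distance to [x]. *)
Lemma proj_outer_normal X x u p : bary_hull X x ->
  (forall j, dotp (X j - x) u <= 0) -> is_proj X (x + u) p -> p = x.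
Proof.
move=> Cx hu [[w sw <-] hp]; have := hp _ Cx.
rewrite -subr_ge0 obsB (addrC x) addrK => h.
have : dotp (barycenter X w - x) u <= 0.
  rewrite dotpDl dotpNl subr_le0; apply: dotp_barycenter_le => // j.
  by rewrite -subr_le0 -dotpNl -dotpDl.
have := nsq_ge0 (barycenter X w - x) => D0 le0.
apply/eqP; rewrite -subr_eq0; apply/eqP/nsq_eq0; lra.
Qed.

End hull.

(** * Outer normals at the vertices *)

Section vertices.
Variables (R : realType) (d n : nat).
Implicit Types (X Y : 'I_n -> 'rV[R]_d) (C : set 'rV[R]_d).

Definition segment_closed C := forall x y t, C x -> C y -> 0 < t < 1 ->
  C (t *: x + (1 - t) *: y).

Lemma segment_closed_hull C : segment_closed (convex_hull C).
Proof.
move=> x y t hx hy /andP[t0 t1] B [cB CB].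
have Bx : B x by exact: hx.
have By : B y by exact: hy.
have t01 : 0 <= t <= 1 by rewrite !ltW.
have /convex_setW h := cB.
by have := h x y (mem_set Bx) (mem_set By) (Itv01 (ltW t0) (ltW t1)) t0 t1;
  move/set_mem.
Qed.

Lemma segment_closed_barycenter C Y w : segment_closed C -> (forall j, C (Y j)) ->
  simplex w -> C (barycenter Y w).
Proof.
move=> cC CY [w0 w1].
(* Normalised partial sums stay in [C] as long as their weight is positive. *)
have key (s : seq 'I_n) :
  let W := \sum_(j <- s) w ord0 j in let S := \sum_(j <- s) w ord0 j *: Y j in
  W = 0 /\ S = 0 \/ 0 < W /\ C (W^-1 *: S).
  elim: s => [|a s /= IH]; first by left; rewrite !big_nil.
  rewrite !big_cons; move: IH.
  set W := \sum_(j <- s) _; set S := \sum_(j <- s) _.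
  have [/eqP|wa IH] := ltrP 0 (w ord0 a); last first.
    have -> : w ord0 a = 0 by apply/eqP; rewrite eq_le wa w0.
    by rewrite add0r scale0r add0r.
  rewrite eqb_id => wa [[-> ->]|[W0 CS]]; right.
    rewrite !addr0 scalerA mulVf ?gt_eqF// scale1r; split=> //; exact: CY.
  split; first exact: addr_gt0.
  have t01 : 0 < w ord0 a / (w ord0 a + W) < 1.
    by rewrite divr_gt0 ?addr_gt0// ltr_pdivrMr ?addr_gt0// mul1r ltrDl.
  have := cC _ _ _ (CY a) CS t01; congr C.
  rewrite scalerDr !scalerA; congr (_ *: _ + _ *: _); first exact: mulrC.
  have aW : w ord0 a + W != 0 by rewrite gt_eqF// addr_gt0.
  have Wn : W != 0 by rewrite gt_eqF.
  by field; rewrite aW Wn.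
have := key (index_enum 'I_n); rewrite /= w1 invr1 scale1r.
by case=> [[/eqP]|[]//]; rewrite oner_eq0.
Qed.

(** A vertex has a nonzero outer normal: by extremality it is not in the hull of
    the points of the family that differ from it, and the direction from its
    projection onto that hull separates. *)
Lemma extreme_point_normal X x : (0 < d)%N ->
  extreme_points (convex_hull (range X)) x ->
  exists u, [/\ exists i, X i = x, u != 0 & forall j, dotp (X j - x) u <= 0].
Proof.
move=> d0 xe; have [i _ Xi] := extreme_points_convex_hull xe.
have [allx|] := pselect (forall j, X j = x).
  exists (const_mx 1); split; first by exists i.
    apply/eqP => /rowP/(_ (Ordinal d0)); rewrite !mxE.
    by move/eqP; rewrite oner_eq0.
  by move=> j; rewrite allx subrr dotp0l.
move=> /existsNP[j0 xj0].
(* [Y] keeps the index type while it only takes values other than [x]. *)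
pose Y j := if X j == x then X j0 else X j.
have Yx j : Y j <> x by rewrite /Y; case: eqP.
have YX j : range X (Y j) by rewrite /Y; case: ifP => _; [exists j0|exists j].
have n0 : (0 < n)%N by case: (n) i {Xi} => // -[].
have [p pp] := exists_proj Y x n0.
have xp : x - p != 0.
  rewrite subr_eq0; apply/eqP => xp.
  have [[w sw pw] _] := pp; case: xe => _ ext.
  suff : (convex_hull (range X) `\ x) (barycenter Y w) by case => _; apply; rewrite /= pw.
  apply: segment_closed_barycenter sw.
    move=> y z t [hy yx] [hz zx] t01; split; first exact: segment_closed_hull.
    by move=> /= tx; apply: yx; have [] := ext y z t hy hz t01 (esym tx).
  by move=> j; split; [move=> B [_]; apply; exact: YX|exact: Yx].
exists (x - p); split=> //; first by exists i.
move=> j; have [->|/eqP xj] := eqVneq (X j) x; first by rewrite subrr dotp0l.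
have := proj_obtuse pp (bary_hull_family Y j).
rewrite /Y; case: eqP => // _.
by have := nsq_ge0 (x - p); rewrite /nsq !dotpDl !dotpNl; lra.
Qed.

End vertices.

Section escape.
Variables (R : realType) (d : nat).

(** Faces of the cube of half-side 3. The sample points lie in the cube of
    half-side 1, so that in the direction [f.1] they stay at distance at least 2
    from the face, on one side of it. *)
Definition in_face (f : 'I_d * bool) (y : 'rV[R]_d) :=
  y ord0 f.1 = (-1) ^+ f.2 * 3 /\ forall k, `|y ord0 k| <= 3.

(** The face is the one whose coordinate has the smallest exit time. *)
Lemma ray_hits_face (x u : 'rV[R]_d) : u != 0 -> (forall k, `|x ord0 k| <= 1) ->
  exists f, exists2 t, 0 < t & in_face f (x + t *: u).
Proof.
move=> u0 hx.
have [k0 uk0] : exists k, u ord0 k != 0.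
  apply: contrapT => /forallNP h; move/eqP: u0; apply; apply/rowP => k.
  by rewrite mxE; apply/eqP; move: (h k) => /negP; rewrite negbK.
pose time k := ((-1) ^+ (u ord0 k < 0)%R * 3 - x ord0 k) / u ord0 k.
have sgu k : u ord0 k = (-1) ^+ (u ord0 k < 0)%R * `|u ord0 k|.
  by rewrite -numEsign.
have [j uj jmin] := @arg_minP _ _ _ k0 (fun k => u ord0 k != 0) time uk0.
have tE k : u ord0 k != 0 -> x ord0 k + time k * u ord0 k = (-1) ^+ (u ord0 k < 0)%R * 3.
  by move=> uk; rewrite /time divfK// addrC subrK.
have tpos : 0 < time j.
  move: (tE j uj) (hx j); rewrite ler_norml; case: ltrP => uj0.
    rewrite expr1 => e /andP[h1 h2]; rewrite ltNge; apply/negP => tj.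
    have := mulr_le0 tj (ltW uj0); lra.
  rewrite expr0 => e /andP[h1 h2]; rewrite ltNge; apply/negP => tj.
  have := mulr_le0_ge0 tj uj0; lra.
exists (j, (u ord0 j < 0)%R); exists (time j) => //; split=> [|k]; rewrite !mxE//=.
  exact: tE.
have [->|uk] := eqVneq (u ord0 k) 0; first by rewrite mulr0 addr0 (le_trans (hx k))// ler1n.
have := jmin k uk; move: (tE k uk) (hx k) => + + tjk; rewrite !ler_norml; case: ltrP => ukS.
  rewrite expr1 => e /andP[h1 h2].
  have := mulr_ge0_le0 (ltW tpos) (ltW ukS); have : (time k - time j) * u ord0 k <= 0.
    by rewrite mulr_ge0_le0// ?subr_ge0// ltW.
  rewrite mulrBl; lra.
rewrite expr0 => e /andP[h1 h2].
have := mulr_ge0 (ltW tpos) ukS; have : 0 <= (time k - time j) * u ord0 k.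
  by rewrite mulr_ge0// subr_ge0.
rewrite mulrBl; lra.
Qed.

End escape.

(** * Entropy of functions with Lipschitz gradient on the cube boundary *)

Section rounding.
Variable R : realType.

(** The cells [[e, e + 1]] are closed so that the right end of [[0, m]] is
    covered too. *)
Lemma exists_cell m (s : R) : (0 < m)%N -> 0 <= s <= m%:R ->
  exists e : 'I_m, e%:R <= s <= e%:R + 1.
Proof.
case: m => // m _ /andP[s0 sm].
have [sm'|ms] := leP m%:R s.
  by exists ord_max; rewrite /= sm' natr1 sm.
have /andP[h1 h2] := truncn_itv s0.
have tm : (Num.truncn s < m.+1)%N.
  by rewrite ltnS -(ler_nat R) (le_trans h1)// ltW.
by exists (Ordinal tm); rewrite /= h1 natr1 ltW.
Qed.

Lemma exists_rounding m (u t : R) : (0 < m)%N -> 0 < u -> `|t| <= m%:R * u ->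
  exists e : 'I_(m + m), `|t - (e%:R - m%:R) * u| <= u.
Proof.
move=> m0 u0; rewrite ler_norml => /andP[t1 t2].
have [||e /andP[e1 e2]] := @exists_cell (m + m) (t / u + m%:R) _ _.
- by rewrite addn_gt0 m0.
- by rewrite natrD lerD2r ler_pdivrMr// t2 andbT -lerBlDr sub0r ler_pdivlMr// mulNr.
exists e; have tu : t = t / u * u by rewrite divfK// gt_eqF.
rewrite {1}tu -mulrBl normrM (gtr0_norm u0) ger_pMl// ler_norml; lra.
Qed.

End rounding.

Section net.
Variables (R : realType) (d' : nat).
Local Notation d := d'.+1.

Definition eps l : R := 2^-1 ^+ l.

Lemma eps_gt0 l : 0 < eps l. Proof. by rewrite exprn_gt0// invr_gt0. Qed.

Lemma epsS l : eps l.+1 = eps l / 2. Proof. by rewrite /eps exprS mulrC. Qed.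

Lemma epsK l : (2 ^ l)%:R * eps l = 1.
Proof. by rewrite /eps natrX -exprMn divff ?expr1n. Qed.

(** Node [((j, b), c)] is the centre of a cell of the face [(j, b)]; [c] ranges
    over the [d'] coordinates other than [j], whence a number of nodes of order
    [2 ^ (l d')] only. *)
Definition net l : finType := (('I_d * bool) * {ffun 'I_d' -> 'I_(2 ^ l)})%type.

Definition cell_center l (c : 'I_(2 ^ l)) : R := (2 * c%:R + 1) * (3 * eps l) - 3.

Definition net_point l (i : net l) : 'rV[R]_d :=
  \row_k if unlift i.1.1 k is Some k' then cell_center (i.2 k')
         else (-1) ^+ i.1.2 * 3.

Lemma card_net l : #|net l| = (2 * d * 2 ^ (l * d'))%N.
Proof.
by rewrite !card_prod card_bool card_ffun !card_ord expnM (mulnC 2).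
Qed.

Lemma cell_center_bound l (c : 'I_(2 ^ l)) : `|cell_center c| <= 3.
Proof.
have e0 := eps_gt0 l; have := epsK l.
have : c%:R + 1 <= (2 ^ l)%:R :> R by rewrite natr1 ler_nat.
move=> cl eK; have : (c%:R + 1) * eps l <= 1 by rewrite -[leRHS]eK ler_wpM2r ?(ltW e0).
have : 0 <= c%:R * eps l :> R by rewrite mulr_ge0// ltW.
rewrite ler_norml /cell_center; lra.
Qed.

Lemma net_point_in_face l (i : net l) : in_face i.1 (net_point i).
Proof.
split=> [|k]; rewrite mxE; first by rewrite unlift_none.
case: unliftP => [k' _|_]; first exact: cell_center_bound.
by rewrite normrMsign normr_nat.
Qed.

Lemma net_cover l f (y : 'rV[R]_d) : in_face f y ->
  exists2 i : net l, i.1 = f & forall k, `|(y - net_point i) ord0 k| <= 3 * eps l.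
Proof.
move=> [yf yb]; have e0 := eps_gt0 l; have eK := epsK l.
have cell (k : 'I_d') : exists c : 'I_(2 ^ l),
    `|y ord0 (lift f.1 k) - cell_center c| <= 3 * eps l.
  pose t := y ord0 (lift f.1 k).
  have := yb (lift f.1 k); rewrite -/t ler_norml => /andP[t1 t2].
  have [||c /andP[c1 c2]] := @exists_cell R (2 ^ l) ((t + 3) / 6 * (2 ^ l)%:R) _ _.
  - by rewrite expn_gt0.
  - rewrite mulr_ge0/= ?ler_piMl//; lra.
  have tE : (t + 3) / 6 * (2 ^ l)%:R * eps l = (t + 3) / 6 by rewrite -mulrA eK mulr1.
  move: c1; rewrite -(ler_pM2r e0) tE => c1.
  move: c2; rewrite -(ler_pM2r e0) tE => c2.
  by exists c; rewrite -/t ler_norml /cell_center; lra.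
have [c hc] := choice cell.
exists (f, [ffun k => c k]) => // k; rewrite !mxE /=.
case: unliftP => [k' ->|->]; first by rewrite ffunE.
by rewrite yf subrr normr0 mulr_ge0// ltW.
Qed.

(** What the entropy bound uses of the maximum of [obs y] over a hull and of the
    projection: a function and its gradient, with second-order control of the
    Taylor remainder, and a bound that starts the induction. *)
Definition smooth_pair (phi : 'rV[R]_d -> R) (pi : 'rV[R]_d -> 'rV[R]_d) :=
  [/\ forall y1 y2, nsq (pi y2 - pi y1) <= nsq (y2 - y1),
      forall y1 y2,
        0 <= phi y2 - phi y1 - dotp (pi y1) (y2 - y1) <= nsq (y2 - y1),
      forall (y : 'rV[R]_d) k, `|pi y ord0 k| <= 1 &
      forall y : 'rV[R]_d, (forall k, `|y ord0 k| <= 3) -> `|phi y| <= 4 * d%:R].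

(** At a node the inherited errors are at most twice the precisions of the
    previous net. The gradient coordinates are corrected in steps of half, and
    the value in steps of a quarter, of these precisions: 4 and 8 steps to either
    side. *)
Definition correction : finType := ({ffun 'I_d -> 'I_(4 + 4)} * 'I_(8 + 8))%type.

Definition corr_bound := (8 ^ d * 16)%N.

Lemma card_correction : #|{: correction}| = corr_bound.
Proof. by rewrite card_prod card_ffun !card_ord. Qed.

Lemma d_ge1 : 1 <= d%:R :> R. Proof. by rewrite ler1n. Qed.

(** The codes of level [l + 1] are a code of level [l] and a correction at each
    node, applied to the Taylor prediction from a parent node. The gradient then
    needs precision of order [eps] and the value of order [eps ^ 2]. The constants
    [3 d] and [18 d ^ 2] make the prediction error at most twice the precision:
    the gradient moves by at most [3 d eps] from parent to child, and the value is
    off by [9 d ^ 2 eps ^ 2] because of the gradient and by [9 d eps ^ 2] because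
    of the Taylor remainder. The factor 2 in the exponent absorbs the earlier
    levels, as the size of the net at least doubles at each level. *)
Lemma jet_entropy l : (0 < d')%N ->
  exists (J : finType) (p : J -> net l -> 'rV[R]_d) (a : J -> net l -> R),
    (#|J| <= corr_bound ^ (2 * #|net l|))%N /\
    forall phi pi, smooth_pair phi pi -> exists j, forall i,
      (forall k, `|(pi (net_point i) - p j i) ord0 k| <= 3 * d%:R * eps l) /\
      `|phi (net_point i) - a j i| <= 18 * d%:R ^+ 2 * eps l ^+ 2.
Proof.
move=> d'0; have d1 := d_ge1.
elim: l => [|l [J [p [a [cJ hJ]]]]].
  exists unit, (fun _ _ => 0), (fun _ _ => 0); split.
    by rewrite card_unit expn_gt0 /corr_bound muln_gt0 expn_gt0.
  move=> phi pi [_ _ pi1 phi1]; exists tt => i; split=> [k|].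
    rewrite subr0 (le_trans (pi1 _ _))// /eps expr0; lra.
  rewrite subr0 (le_trans (phi1 _ (net_point_in_face i).2))// /eps expr0 expr1n.
  rewrite expr2; nra.
have par (i : net l.+1) : exists i0 : net l,
    forall k, `|(net_point i - net_point i0) ord0 k| <= 3 * eps l.
  by have [i0 _ h] := net_cover l (net_point_in_face i); exists i0.
have {par}[par hpar] := choice par.
pose D i := net_point i - net_point (par i).
pose J' : finType := (J * {ffun net l.+1 -> correction})%type.
exists J',
  (fun (je : J') i => p je.1 (par i) +
    \row_k ((((je.2 i).1 k)%:R - 4) * (3 * d%:R * eps l.+1))),
  (fun (je : J') i => a je.1 (par i) + dotp (p je.1 (par i)) (D i) +
    ((je.2 i).2%:R - 8) * (18 * d%:R ^+ 2 * eps l.+1 ^+ 2)).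
split.
  rewrite card_prod card_ffun card_correction.
  have cn : (2 * #|net l| <= #|net l.+1|)%N.
    have le2 : (2 ^ 1 <= 2 ^ d')%N by rewrite leq_exp2l.
    rewrite !card_net mulnCA; apply: leq_mul => //.
    by rewrite (mulSn l) expnD; apply: leq_mul.
  rewrite mul2n -addnn expnD; apply: leq_mul => //; apply: leq_trans cJ _.
  rewrite leq_exp2l//.
  by rewrite /corr_bound (leq_trans (isT : 1 < 1 * 16)%N)// leq_mul2r expn_gt0.
move=> phi pi sm; have [j hj] := hJ _ _ sm.
have [lip taylor _ _] := sm.
have e0 := eps_gt0 l; have d0 : 0 < d%:R :> R by rewrite ltr0n.
set E := eps l in hj hpar e0 *; pose E1 := 3 * d%:R * eps l.+1.
pose E2 := 18 * d%:R ^+ 2 * eps l.+1 ^+ 2.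
have E1_0 : 0 < E1 by rewrite /E1 !mulr_gt0// ?eps_gt0.
have E2_0 : 0 < E2 by rewrite /E2 !mulr_gt0// ?exprn_gt0// ?eps_gt0.
have nD i : nsq (D i) <= d%:R * (3 * E) ^+ 2 
  by apply: le_nsq => k; exact: hpar.
have b1 i k : `|(pi (net_point i) - p j (par i)) ord0 k| <= 4%:R * E1.
  have h1 := (hj (par i)).1 k.
  have h2 : `|(pi (net_point i) - pi (net_point (par i))) ord0 k| <= d%:R * (3 * E).
    apply: ler_norm_coord => //; first by rewrite mulr_ge0// ltW.
    exact: le_trans (lip _ _) (nD i).
  rewrite (_ : _ ord0 k = (pi (net_point i) - pi (net_point (par i))) ord0 k +
    (pi (net_point (par i)) - p j (par i)) ord0 k); last by rewrite !mxE; ring.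
  rewrite (le_trans (ler_normD _ _))// (le_trans (lerD h2 h1))//.
  by rewrite /E1 epsS -/E; lra.
have b2 i : `|phi (net_point i) - (a j (par i) + dotp (p j (par i)) (D i))|
    <= 8%:R * E2.
  have h1 := (hj (par i)).2.
  have /andP[t1 t2] := taylor (net_point (par i)) (net_point i).
  have h2 := ler_norm_dotp (hj (par i)).1 (hpar i).
  move: h1 h2 (nD i); rewrite -/(D i) in t1 t2 *; rewrite -/(D i).
  rewrite dotpDl dotpNl !ler_norml => /andP[u1 u2] /andP[v1 v2] w.
  have dd : d%:R * E ^+ 2 <= d%:R ^+ 2 * E ^+ 2.
    by rewrite ler_wpM2r ?sqr_ge0// expr2 ler_peMr.
  rewrite /E2 epsS -/E; apply/andP; move: u1 u2 v1 v2 w dd.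
  by rewrite !expr2 => *; split; lra.
have corr i : exists e : correction,
    (forall k, `|(pi (net_point i) - p j (par i)) ord0 k - ((e.1 k)%:R - 4) * E1| <= E1) /\
    `|phi (net_point i) - (a j (par i) + dotp (p j (par i)) (D i)) -
       (e.2%:R - 8) * E2| <= E2.
  have [e2 he2] := @exists_rounding R 8 E2 _ isT E2_0 (b2 i).
  have [e1 he1] := choice (fun k => @exists_rounding R 4 E1 _ isT E1_0 (b1 i k)).
  by exists ([ffun k => e1 k], e2); split=> //= k; rewrite ffunE.
have [e he] := choice corr.
exists (j, [ffun i => e i]) => i; have [h1 h2] := he i; split=> [k|].
  move: (h1 k); rewrite !mxE /= !ffunE -/E1; apply: le_trans.
  by rewrite opprD addrA.
by move: h2; rewrite /= !ffunE -/E2; apply: le_trans; rewrite opprD addrA.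
Qed.

End net.

(** * Plates containing the vertices, and their volume *)

Section plates.
Variables (R : realType) (d' : nat).
Local Notation d := d'.+1.
Implicit Types (x y p : 'rV[R]_d).

Lemma proj_smooth_pair n (X : 'I_n -> 'rV[R]_d) pi :
  (forall i k, `|X i ord0 k| <= 1) -> (forall y, is_proj X y (pi y)) ->
  smooth_pair (fun y => obs y (pi y)) pi.
Proof.
move=> X1 hpi.
have pi1 y k : `|pi y ord0 k| <= 1.
  by have [[w sw <-] _] := hpi y; exact: barycenter_box.
split=> // [y1 y2|y1 y2|y y3].
- exact: proj_nonexpansive (hpi y1) (hpi y2).
- exact: proj_taylor.
have h1 := ler_norm_dotp (pi1 y) y3.
have := le_nsq (pi1 y); have := nsq_ge0 (pi y).
have := d_ge1 R d'; move: h1; rewrite /obs !ler_norml => /andP[? ?]; lra.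
Qed.

(** The last condition confines [x] between two concentric spheres centred at [y],
    whose squared radii differ by [O(eps ^ 2)]. *)
Definition plate l y p a x := [/\ forall k, `|x ord0 k| <= 1,
  forall k, `|(x - p) ord0 k| <= 6 * d%:R * eps R l &
  `|obs y x - a| <= 27 * d%:R ^+ 2 * eps R l ^+ 2].

(** A vertex [x] is the projection of some [y] on the cube boundary. Let [z] be a
    node near [y]: its projection is close to [x], and since [obs z x] is the
    Taylor prediction at [z] of the maximum, made from [y], the gap between them
    is of second order. *)
Lemma extreme_point_in_plate n (X : 'I_n -> 'rV[R]_d) pi l
    (p : net d' l -> 'rV[R]_d) (a : net d' l -> R) x :
  (forall i k, `|X i ord0 k| <= 1) -> (forall y, is_proj X y (pi y)) ->
  (forall i : net d' l,
     (forall k, `|(pi (net_point R i) - p i) ord0 k| <= 3 * d%:R * eps R l) /\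
     `|obs (net_point R i) (pi (net_point R i)) - a i|
        <= 18 * d%:R ^+ 2 * eps R l ^+ 2) ->
  extreme_points (convex_hull (range X)) x ->
  exists i : net d' l, plate l (net_point R i) (p i) (a i) x.
Proof.
move=> X1 hpi hpa xe; have d1 := d_ge1 R d'; have e0 := eps_gt0 R l.
have [u [[i0 Xi0] u0 hu]] := extreme_point_normal (ltn0Sn _) xe.
have x1 k : `|x ord0 k| <= 1 by rewrite -Xi0.
have [f [t t0 ff]] := ray_hits_face u0 x1.
have xhull : bary_hull X x by rewrite -Xi0; exact: bary_hull_family.
have tu j : dotp (X j - x) (t *: u) <= 0.
  by rewrite dotpZr mulr_ge0_le0// ltW.
have pix : pi (x + t *: u) = x := proj_outer_normal xhull tu (hpi _).
move: ff pix; set y := x + t *: u => ff pix.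
have [i _ yi] := net_cover l ff; exists i.
have [hp ha] := hpa i; set z := net_point R i in yi hp ha *.
have zy k : `|(z - y) ord0 k| <= 3 * eps R l.
  by have := yi k; rewrite -opprB mxE normrN.
have nzy := le_nsq zy.
split=> // [k|].
  have h : `|(pi z - x) ord0 k| <= d%:R * (3 * eps R l).
    apply: ler_norm_coord => //; first by rewrite mulr_ge0// ltW.
    by rewrite -pix; apply: le_trans nzy; exact: proj_nonexpansive (hpi _) (hpi _).
  have := hp k; rewrite (_ : (x - p i) ord0 k =
    (pi z - p i) ord0 k - (pi z - x) ord0 k); last by rewrite !mxE; ring.
  move=> h'; rewrite (le_trans (ler_normB _ _))// (le_trans (lerD h' h))//; lra.
have /andP[] := proj_taylor (hpi y) (hpi z); rewrite pix -obsBy => t1 t2.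
have dd : d%:R * eps R l ^+ 2 <= d%:R ^+ 2 * eps R l ^+ 2.
  by rewrite ler_wpM2r ?sqr_ge0// expr2 ler_peMr// ltW// ltr0n.
move: ha nzy dd; rewrite !expr2 !ler_norml => /andP[? ?] ? ?.
by apply/andP; split; lra.
Qed.

(** A plate is the thickening, in the direction of the face of [y], of a
    Lipschitz graph: [obs y] has slope at least 2 in that direction, because
    [y] is at distance at least 2 from the cube of half-side 1, and at most 4 in
    the others. *)
Lemma plate_thickness l f y p a x z : in_face f y ->
  plate l y p a x -> plate l y p a z ->
  (forall k, k != f.1 -> `|(x - z) ord0 k| <= eps R l ^+ 2) ->
  `|(x - z) ord0 f.1| <= 29 * d%:R ^+ 2 * eps R l ^+ 2.
Proof.
move=> [yf y3] [x1 _ hx] [z1 _ hz] hxz; have d1 := d_ge1 R d'.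
pose s k := y ord0 k - (x ord0 k + z ord0 k) / 2.
have sE : obs y x - obs y z = \sum_k (x - z) ord0 k * s k.
  rewrite /obs /nsq /dotp !mulr_suml -!sumrB; apply: eq_bigr => k _.
  by rewrite /s !mxE; lra.
have s4 k : `|s k| <= 4.
  have := x1 k; have := z1 k; have := y3 k; rewrite /s !ler_norml; lra.
have sf : 2 <= `|s f.1|.
  have := x1 f.1; have := z1 f.1; rewrite /s yf ler_normr !ler_norml.
  move=> /andP[z11 z12] /andP[x11 x12]; apply/orP.
  by case: (f.2); rewrite ?expr1 ?expr0; [right|left]; lra.
have e0 := sqr_ge0 (eps R l).
have rest : `|\sum_(k < d | k != f.1) (x - z) ord0 k * s k| <= d%:R * (eps R l ^+ 2 * 4).
  rewrite mulr_natl -[X in _ *+ X]card_ord -sumr_const.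
  rewrite (le_trans (ler_norm_sum _ _ _))// big_mkcond ler_sum//= => k _.
  by case: ifP => [kf|_]; [rewrite normrM ler_pM// hxz|rewrite mulr_ge0].
have main : `|(x - z) ord0 f.1| * 2 <= `|(x - z) ord0 f.1 * s f.1|.
  by rewrite normrM ler_wpM2l.
have tot : `|(x - z) ord0 f.1 * s f.1| <=
    54 * d%:R ^+ 2 * eps R l ^+ 2 + d%:R * (eps R l ^+ 2 * 4).
  rewrite (_ : (x - z) ord0 f.1 * s f.1 = (obs y x - a) - (obs y z - a) -
    \sum_(k < d | k != f.1) (x - z) ord0 k * s k); last first.
    rewrite opprB addrA subrK sE (bigD1 f.1)//=; ring.
  rewrite (le_trans (ler_normB _ _))// lerD//.
  rewrite (le_trans (ler_normB _ _))// (le_trans (lerD hx hz))//; lra.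
have dd : d%:R * eps R l ^+ 2 <= d%:R ^+ 2 * eps R l ^+ 2.
  by rewrite ler_wpM2r// expr2 ler_peMr// ltW// ltr0n.
by move: tot main dd; rewrite !expr2; lra.
Qed.

Definition box (c : 'rV[R]_d) (r : 'I_d -> R) : set 'rV[R]_d :=
  [set x | forall k, x ord0 k \in `[c ord0 k - r k, c ord0 k + r k]].

Definition plate_radius l (j k : 'I_d) : R :=
  if k == j then 29 * d%:R ^+ 2 * eps R l ^+ 2 else eps R l ^+ 2.

(** Cut the [d'] directions along the face into intervals of length [eps ^ 2]; a
    point of the plate in each column, when there is one, is the centre of a box
    that contains the whole part of the plate in the column. *)
Lemma plate_boxes l f y p a : in_face f y ->
  exists c : {ffun 'I_d' -> 'I_(12 * d * 2 ^ l)} -> 'rV[R]_d,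
    forall x, plate l y p a x -> exists i, box (c i) (plate_radius l f.1) x.
Proof.
move=> yf; have e0 := eps_gt0 R l; have eK := epsK R l.
have ee0 : 0 < eps R l ^+ 2 by rewrite exprn_gt0.
pose low k := p ord0 k - 6 * d%:R * eps R l.
pose column (i : {ffun 'I_d' -> 'I_(12 * d * 2 ^ l)}) (x : 'rV[R]_d) := forall k,
  (i k)%:R * eps R l ^+ 2 <= x ord0 (lift f.1 k) - low (lift f.1 k) <=
  ((i k)%:R + 1) * eps R l ^+ 2.
have pick i : exists c, forall x, plate l y p a x -> column i x ->
    plate l y p a c /\ column i c.
  have [[c hc]|no] := pselect (exists c, plate l y p a c /\ column i c).
    by exists c.
  by exists 0 => x h1 h2; exfalso; apply: no; exists x.
have [c hc] := choice pick; exists c => x px.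
have [_ xp _] := px.
have [i xi] : exists i, column i x.
  have cell (k : 'I_d') : exists e : 'I_(12 * d * 2 ^ l),
    e%:R * eps R l ^+ 2 <= x ord0 (lift f.1 k) - low (lift f.1 k) <=
    (e%:R + 1) * eps R l ^+ 2.
    set t := x ord0 _ - _.
    have t0 : 0 <= t <= 12 * d%:R * eps R l.
      by have := xp (lift f.1 k); rewrite /t /low ler_norml !mxE; lra.
    have [||e he] := @exists_cell R (12 * d * 2 ^ l) (t / eps R l ^+ 2) _ _.
    - by rewrite muln_gt0 expn_gt0.
    - case/andP: t0 => t0 t1; rewrite divr_ge0 ?(ltW ee0)//= ler_pdivrMr//.
      have -> : (12 * d * 2 ^ l)%:R * eps R l ^+ 2 =
          12 * d%:R * ((2 ^ l)%:R * eps R l) * eps R l by rewrite !natrM; ring.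
      by rewrite eK mulr1.
    exists e; case/andP: he => h1 h2.
    by apply/andP; split; [rewrite -ler_pdivlMr|rewrite -ler_pdivrMr].
  by have [e he] := choice cell; exists [ffun k => e k] => k; rewrite ffunE.
have [pc ci] := hc i x px xi; exists i => k.
suff : `|(x - c i) ord0 k| <= plate_radius l f.1 k.
  by rewrite !mxE ler_norml in_itv/= => /andP[? ?]; apply/andP; split; lra.
have off k' : k' != f.1 -> `|(x - c i) ord0 k'| <= eps R l ^+ 2.
  case: (unliftP f.1 k') => [k'' -> _|->]; last by rewrite eqxx.
  have /andP[] := xi k''; have /andP[] := ci k''; rewrite !mxE ler_norml => *.
  by apply/andP; split; lra.
rewrite /plate_radius; case: eqP => [->|/eqP]; last exact: off.
exact: plate_thickness yf px pc off.
Qed.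

End plates.

Section cap_cover.
Variables (R : realType) (d' : nat).
Local Notation d := d'.+1.

Lemma box_bigcap (c : 'rV[R]_d) r : box c r =
  [set x : 'rV[R]_d | forall k, `[c ord0 k - r k, c ord0 k + r k]%classic (x ord0 k)].
Proof. by apply/seteqP; split=> x h k; have := h k; rewrite /= ?in_itv. Qed.

Lemma measurable_box (c : 'rV[R]_d) r : measurable (box c r : set 'rV[R]_d).
Proof.
rewrite box_bigcap (_ : mkset _ = \bigcap_(k : 'I_d)
  (fun x : 'rV[R]_d => x ord0 k) @^-1` `[c ord0 k - r k, c ord0 k + r k]%classic).
  apply: fin_bigcap_measurable => // k _.
  by rewrite -[X in measurable X]setTI; exact: measurable_coord.
by apply/seteqP; split=> x /= h k; [move=> _|]; exact: h.
Qed.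

Lemma lebesgue_box (c : 'rV[R]_d) r : (forall k, 0 < r k) ->
  lebesgue_row R d (box c r) = (\prod_k (2 * r k))%:E.
Proof.
move=> r0; rewrite box_bigcap.
rewrite (@lebesgue_row_box R d (fun k => `[c ord0 k - r k, c ord0 k + r k]%classic))//.
rewrite -prodEFin; apply: eq_bigr => k _.
rewrite lebesgue_measure_itv/= lte_fin.
have := r0 k; case: ifPn => [_ _|]; last first.
  by rewrite -leNgt => ? ?; exfalso; lra.
by rewrite -EFinB; congr (_%:E); ring.
Qed.

Lemma lebesgue_plate_box l j (c : 'rV[R]_d) :
  lebesgue_row R d (box c (plate_radius R l j)) =
  (58 * d%:R ^+ 2 * eps R l ^+ 2 * (2 * eps R l ^+ 2) ^+ d')%:E.
Proof.
have ee0 : 0 < eps R l ^+ 2 by rewrite exprn_gt0// eps_gt0.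
rewrite lebesgue_box; last first.
  move=> k; rewrite /plate_radius; case: ifP => _ //.
  by rewrite !mulr_gt0// exprn_gt0// ltr0n.
congr (_%:E); rewrite (bigD1 j)//= /plate_radius eqxx.
rewrite (eq_bigr (fun _ => 2 * eps R l ^+ 2)); last by move=> k /negbTE ->.
rewrite prodr_const cardC1 card_ord /=; ring.
Qed.

Lemma measure_bigsetU_le disp (T : measurableType disp)
    (mu : {measure set T -> \bar R}) (I : Type) (s : seq I) (F : I -> set T) :
  (forall i, measurable (F i)) ->
  (mu (\big[setU/set0]_(i <- s) F i) <= \sum_(i <- s) mu (F i))%E.
Proof.
move=> mF; elim: s => [|i s IH]; first by rewrite !big_nil measure0.
rewrite !big_cons; apply: le_trans (leeD2l _ IH).
by apply: measureU2 => //; exact: bigsetU_measurable.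
Qed.

Definition cover_const : R := 116 * d%:R ^+ 3 * (24 * d%:R) ^+ d'.

(** There are [O(2 ^ (l d'))] plates, each covered by [O(2 ^ (l d'))] boxes of
    volume [O(eps ^ (2 d))]. *)
Lemma cap_cover l : (0 < d')%N ->
  exists (J : finType) (A : J -> set 'rV[R]_d),
  [/\ (#|J| <= corr_bound d' ^ (2 * #|net d' l|))%N,
      forall j, measurable (A j),
      forall j, (lebesgue_row R d (A j) <= (cover_const * eps R l ^+ 2)%:E)%E &
      forall n (X : 'I_n -> 'rV[R]_d), (0 < n)%N -> (forall i k, `|X i ord0 k| <= 1) ->
        exists j, extreme_points (convex_hull (range X)) `<=` A j].
Proof.
move=> d'0; have [J [p [a [cJ hJ]]]] := @jet_entropy R d' l d'0.
have [c hc] := choice (fun ji : J * net d' l =>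
  plate_boxes l (p ji.1 ji.2) (a ji.1 ji.2) (net_point_in_face R ji.2)).
pose I : finType := (net d' l * {ffun 'I_d' -> 'I_(12 * d * 2 ^ l)})%type.
pose B j (i : I) := box (c (j, i.1) i.2) (plate_radius R l i.1.1.1).
have mB j i : measurable (B j i) by exact: measurable_box.
exists J, (fun j => \big[setU/set0]_(i : I) B j i); split=> //.
- by move=> j; apply: bigsetU_measurable.
- move=> j; apply: le_trans (measure_bigsetU_le _ _ (mB j)) _.
  under eq_bigr do rewrite lebesgue_plate_box.
  rewrite sumEFin lee_fin sumr_const card_prod card_net card_ffun !card_ord.
  rewrite le_eqVlt; apply/orP; left; apply/eqP.
  rewrite -[LHS]mulr_natl /cover_const expnM !natrM !natrX !natrM natrX.
  have eK := epsK R l; rewrite natrX in eK.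
  set e := eps R l in eK *; set P := 2%:R ^+ l in eK *.
  transitivity (116 * d%:R ^+ 3 * (24 * d%:R) ^+ d' * e ^+ 2 * ((P * e) ^+ d') ^+ 2).
    by rewrite (_ : 24 = 12 * 2 :> R) ?[RHS]mulrA ?exprMn; [ring|ring].
  by rewrite eK !expr1n mulr1.
- move=> n X n0 X1.
  have [pi hpi] := choice (fun y => exists_proj X y n0).
  have [j hj] := hJ _ _ (proj_smooth_pair X1 hpi).
  exists j => x xe; have [i hi] := extreme_point_in_plate X1 hpi hj xe.
  have [b hb] := hc (j, i) x hi.
  by rewrite -bigcup_seq; exists (i, b) => //=; rewrite mem_index_enum.
Qed.

End cap_cover.

(** * Moments of the number of vertices *)

Section counting.
Context {disp disp' : measure_display} {T : measurableType disp}.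
Context {E : measurableType disp'} {R : realType} (P : probability T R).
Implicit Types (A : set E).

(** The integral of an arbitrary nonnegative function is the supremum of the
    integrals of the simple functions below it, so that it is monotone on
    functions such as the number of vertices. *)
Lemma le_integral_nonneg (f g : T -> \bar R) : (forall x, 0 <= f x)%E ->
  (forall x, f x <= g x)%E -> (\int[P]_x f x <= \int[P]_x g x)%E.
Proof.
move=> f0 fg; rewrite !ge0_integralTE//; last first.
  by move=> x; exact: le_trans (fg x).
apply: ereal_sup_le => _ [h hf <-]; exists h => // x.
exact: le_trans (hf x) (fg x).
Qed.

Definition hits n (X : 'I_n -> T -> E) A w : {set 'I_n} := [set i | X i w \in A].

Lemma exp2_hits n (X : 'I_n -> T -> E) A w :
  (2 ^+ #|hits X A w|)%:E = \sum_(J : {set 'I_n})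
    (\1_(\bigcap_(i in [set` J]) X i @^-1` A) w : R)%:E :> \bar R.
Proof.
rewrite sumEFin -natrX -card_powerset -sum1_card natr_sum big_mkcond/=.
congr (_%:E); apply: eq_bigr => J _; rewrite indicE powersetE.
have -> : (w \in \bigcap_(i in [set` J]) X i @^-1` A) = (J \subset hits X A w).
  apply/idP/fintype.subsetP => [/set_mem h i iJ|h].
    by rewrite inE; apply/mem_set; exact: (h i).
  apply/mem_set => i /= iJ; have := h i iJ; rewrite inE => /set_mem; exact.
by case: ifP.
Qed.

Lemma measurable_hit n (X : 'I_n -> {RV P >-> E}) A (J : {set 'I_n}) :
  measurable A -> measurable (\bigcap_(i in [set` J]) X i @^-1` A).
Proof.
move=> mA; apply: fin_bigcap_measurable => // i _.
by rewrite -[X in measurable X]setTI; exact: measurable_funP.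
Qed.

(** The number of subsets of a set of [k] indices is [2 ^ k], so that
    independence, which is about intersections, evaluates the expectation of
    [2 ^ k] directly. *)
Lemma expectation_exp2_hits n (X : 'I_n -> {RV P >-> E}) A (p : R) :
  measurable A -> 0 <= p -> mutually_independent X ->
  (forall i, P (X i @^-1` A) <= p%:E)%E ->
  (\int[P]_w (2 ^+ #|hits (fun i => X i : T -> E) A w|)%:E <= ((1 + p) ^+ n)%:E)%E.
Proof.
move=> mA p0 ind hp.
under eq_integral do rewrite exp2_hits.
rewrite ge0_integral_sum//; last first.
  move=> J; apply/measurable_EFinP; apply: measurable_indic.
  exact: measurable_hit.
have -> : ((1 + p) ^+ n)%:E = \sum_(J : {set 'I_n}) (p ^+ #|J|)%:E :> \bar R.
  rewrite sumEFin -[X in _ ^+ X]card_ord -prodr_const addrC.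
  rewrite bigA_distr; congr (_%:E); apply: eq_bigr => J _.
  by rewrite -big_mkcond prodr_const.
apply: lee_sum => J _; rewrite integral_indic//; last exact: measurable_hit.
rewrite setIT.
have /= -> := ind J (fun=> A) (fun=> mA).
rewrite -prodr_const -prodEFin.
suff /andP[_ //] : (0 <= \prod_(i in J) P (X i @^-1` A) <= \prod_(i in J) p%:E)%E.
elim/big_rec2 : _ => [|i x y _ /andP[x0 xy]]; first by rewrite lee01 lexx.
by rewrite mule_ge0//= lee_pmul.
Qed.

End counting.

Section moments.
Variable R : realType.

(** Above [L], write [t = L + v <= L (1 + v)], and bound [(1 + v) ^ q] by
    [q ^ q exp (1 + v)]. *)
Lemma expr_le_expR q (t L : R) : (0 < q)%N -> 0 <= t -> 1 <= L ->
  t ^+ q <= q%:R ^+ q * expR 1 * L ^+ q * (1 + expR (t - L)).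
Proof.
move=> q0 t0 L1; have q1 : 1 <= q%:R :> R by rewrite ler1n.
have Lq : 0 <= L ^+ q by rewrite exprn_ge0// (le_trans _ L1).
have C1 : 1 <= q%:R ^+ q * expR 1 :> R.
  by rewrite -[leLHS]mulr1 ler_pM ?exprn_ege1// -expR0 ler_expR.
have [tL|Lt] := leP t L.
  have tq : t ^+ q <= L ^+ q by rewrite lerXn2r// nnegrE (le_trans _ L1).
  apply: le_trans tq _; rewrite -[leLHS]mul1r -[leLHS]mulr1 ler_pM ?mul1r//.
    by rewrite ler_peMl.
  by rewrite lerDl expR_ge0.
set v := t - L; have v0 : 0 <= v by rewrite subr_ge0 ltW.
have tv : t ^+ q <= L ^+ q * (1 + v) ^+ q.
  have L0 : 0 <= L by rewrite (le_trans _ L1).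
  have LV : 0 <= L * (1 + v) by apply: mulr_ge0 => //; exact: addr_ge0.
  rewrite -exprMn lerXn2r ?nnegrE//.
  by have := ler_peMl v0 L1; rewrite (mulrDr L 1 v) mulr1 {1}/v; lra.
apply: le_trans tv _.
have ev : (1 + v) ^+ q <= q%:R ^+ q * expR (1 + v).
  have -> : expR (1 + v) = expR ((1 + v) / q%:R) ^+ q.
    by rewrite -expRM_natl mulrC divfK// gt_eqF// ltr0n.
  have v1 : 0 <= 1 + v by exact: addr_ge0.
  have hq : 1 + v <= q%:R * expR ((1 + v) / q%:R).
    rewrite -ler_pdivrMl ?ltr0n// mulrC (le_trans _ (expR_ge1Dx _))//.
    by rewrite lerDr.
  by rewrite -exprMn lerXn2r ?nnegrE// (le_trans v1).
rewrite [leRHS](_ : _ = L ^+ q * (q%:R ^+ q * (expR 1 * (1 + expR v)))); last by ring.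
rewrite ler_wpM2l// (le_trans ev)// ler_wpM2l ?exprn_ge0//.
by rewrite expRD ler_wpM2l ?expR_ge0// lerDr.
Qed.

Definition moment_const q : R := (q%:R / ln 2) ^+ q * expR 1.

Lemma moment_const_gt0 q : (0 < q)%N -> 0 < moment_const q.
Proof.
move=> q0; have l2 : 0 < ln 2 :> R by rewrite ln_gt0// ltr1n.
by rewrite mulr_gt0 ?expR_gt0// exprn_gt0// divr_gt0// ltr0n.
Qed.

Lemma expr_le_exp2 q k (L : R) : (0 < q)%N -> 1 <= L ->
  k%:R ^+ q <= moment_const q * L ^+ q * (1 + 2 ^+ k * expR (- L)).
Proof.
move=> q0 L1; have l2 : 0 < ln 2 :> R by rewrite ln_gt0// ltr1n.
have kl : 0 <= k%:R * ln 2 :> R by rewrite mulr_ge0// ltW.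
have := expr_le_expR q0 kl L1.
rewrite exprMn -ler_pdivlMr ?exprn_gt0//; congr (_ <= _).
have -> : expR (k%:R * ln 2 - L) = 2 ^+ k * expR (- L).
  by rewrite expRD expRM_natl lnK// posrE.
rewrite /moment_const expr_div_n; field.
by rewrite expf_neq0// gt_eqF.
Qed.

End moments.

Section moment_bound.
Context {disp disp' : measure_display} {T : measurableType disp}.
Context {E : measurableType disp'} {R : realType} (P : probability T R).

(** Union bound over the finitely many sets [A j], at the level of exponential
    moments. The null set [bad] costs nothing since [V] is bounded. The assumption
    on [L] makes the expectation of the sum over [j] of [2 ^ k_j] at most
    [exp L], where [k_j] is the number of points in [A j]. *)
Lemma moment_bound n (X : 'I_n -> {RV P >-> E}) (J : finType) (A : J -> set E)
    (V : T -> nat) (bad : set T) (p L : R) q :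
  (0 < q)%N -> 0 <= p -> 1 <= L -> mutually_independent X ->
  (forall j, measurable (A j)) ->
  (forall j i, P (X i @^-1` A j) <= p%:E)%E ->
  #|J|%:R * (1 + p) ^+ n <= expR L ->
  measurable bad -> P bad = 0%E -> (forall w, (V w <= n)%N) ->
  (forall w, ~ bad w -> exists j, (V w <= #|hits (fun i => X i : T -> E) (A j) w|)%N) ->
  (\int[P]_w ((V w)%:R ^+ q)%:E <= (2 * moment_const R q * L ^+ q)%:E)%E.
Proof.
move=> q0 p0 L1 ind mA hA hJ mbad bad0 Vn hV.
have L0 : 0 <= L ^+ q by rewrite exprn_ge0// (le_trans _ L1).
have C0 : 0 < moment_const R q := moment_const_gt0 R q0.
pose a := moment_const R q * L ^+ q; pose b := a * expR (- L).
have a0 : 0 <= a by rewrite mulr_ge0// ltW.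
have b0 : 0 <= b by rewrite mulr_ge0// expR_ge0.
pose h j w : \bar R := (2 ^+ #|hits (fun i => X i : T -> E) (A j) w|)%:E.
have h0 j w : (0 <= h j w)%E by rewrite lee_fin exprn_ge0.
have mh j : measurable_fun setT (h j).
  rewrite (_ : h j = fun w => \sum_(I : {set 'I_n})
    (\1_(\bigcap_(i in [set` I]) X i @^-1` (A j)) w : R)%:E)%E; last first.
    by apply/funext => w; rewrite /h exp2_hits.
  apply: emeasurable_fun_sum => I.
  apply/measurable_EFinP; apply: measurable_indic; exact: measurable_hit.
pose S w := (\sum_j h j w)%E.
have S0 w : (0 <= S w)%E by exact: sume_ge0.
have mS : measurable_fun setT S by exact: emeasurable_fun_sum.
(* On [bad] the crude bound [n ^ q] is used. *)
pose z w : \bar R := ((\1_bad w : R)%:E).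
have mz : measurable_fun setT z.
  by apply/measurable_EFinP; exact: measurable_indic.
have z0 w : (0 <= z w)%E by rewrite lee_fin.
have n0 : 0 <= n%:R ^+ q :> R by rewrite exprn_ge0.
apply: (@le_trans _ _ (\int[P]_w (a%:E + b%:E * S w + (n%:R ^+ q)%:E * z w))%E).
  apply: le_integral_nonneg => w; first by rewrite lee_fin exprn_ge0.
  have [bw|nbw] := pselect (bad w).
    rewrite /z indicE mem_set// mule1; apply: (@le_trans _ _ (n%:R ^+ q)%:E).
      by rewrite lee_fin lerXn2r ?nnegrE// ler_nat.
    by rewrite leeDr// adde_ge0// mule_ge0// lee_fin.
  have [j hj] := hV w nbw.
  rewrite /z indicE memNset// mule0 adde0.
  apply: (@le_trans _ _ (a%:E + b%:E * h j w)%E).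
    rewrite /h -EFinM -EFinD lee_fin.
    apply: le_trans (expr_le_exp2 (V w) q0 L1) _.
    rewrite mulrDr mulr1 lerD2l /b mulrA mulrAC ler_wpM2l//.
    by rewrite ler_weXn2l// ler1n.
  rewrite leeD2l// lee_wpmul2l// /S (bigD1 j)//= leeDl// sume_ge0//.
rewrite ge0_integralD//=; last 4 first.
- by move=> w _; rewrite adde_ge0// mule_ge0.
- by apply: emeasurable_funD => //; exact: measurable_funeM.
- by move=> w _; rewrite mule_ge0.
- exact: measurable_funeM.
rewrite ge0_integralD//=; last 2 first.
- by move=> w _; rewrite mule_ge0.
- exact: measurable_funeM.
have iz : (\int[P]_w z w = 0)%E by rewrite integral_indic// setIT.
rewrite !ge0_integralZl_EFin// integral_cst// iz mule0 adde0.
rewrite /= probability_setT mule1 /S ge0_integral_sum//.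
have : (\sum_j \int[P]_w h j w <= (expR L)%:E)%E.
  apply: (@le_trans _ _ (\sum_(j : J) ((1 + p) ^+ n)%:E)%E).
    by apply: lee_sum => j _; exact: expectation_exp2_hits.
  by rewrite sumEFin lee_fin sumr_const -mulr_natl.
move=> /(lee_wpmul2l (_ : (0 <= b%:E)%E)) -/(_ b0) hb.
apply: le_trans (leeD2l _ hb) _.
have bL : b * expR L = a by rewrite /b -(mulrA a) -expRD addNr expR0 mulr1.
by rewrite -EFinM -EFinD lee_fin bL /a; lra.
Qed.

End moment_bound.

Section vertices_of_random_points.
Variables (R : realType) (d : nat).

Lemma unit_ball_coord (x : 'rV[R]_d) k :
  unit_euclidean_ball R d x -> `|x ord0 k| <= 1.
Proof.
rewrite /unit_euclidean_ball /euclidean_norm /=; apply: le_trans.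
rewrite -sqrtr_sqr ler_wsqrtr// (bigD1 k)//= lerDl.
by apply: sumr_ge0 => i _; exact: sqr_ge0.
Qed.

Lemma vertex_number_le n (x : 'I_n -> 'rV[R]_d) (A : set 'rV[R]_d) :
  extreme_points (convex_hull (range x)) `<=` A ->
  (vertex_number x <= #|[set i | x i \in A]%SET|)%N.
Proof.
move=> hA; pose S := [set i | x i \in A]%SET.
pose F := [fset x i | i in S]%fset.
apply: (@leq_trans #|` F|).
  apply: fsubset_leq_card; apply/fsubsetP => y.
  rewrite in_fset_set; last exact: finite_extreme_points.
  move=> /set_mem ye; have [i _ xy] := extreme_points_convex_hull ye.
  apply/imfsetP; exists i => //=; rewrite inE xy; apply/mem_set; exact: hA.
by apply: leq_trans (leq_imfset_card _ _ _) _; rewrite cardE.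
Qed.

Lemma vertex_number_le_size n (x : 'I_n -> 'rV[R]_d) : (vertex_number x <= n)%N.
Proof.
rewrite -[leqRHS]card_ord; apply: leq_trans (max_card _).
exact: (@vertex_number_le _ x setT).
Qed.

Context {disp : measure_display} {T : measurableType disp} (P : probability T R).
Variables (X : {RV P >-> 'rV[R]_d}) (f : 'rV[R]_d -> R) (M : R).
Hypotheses (fd : probability_density f) (Xf : has_density X f).

Lemma density_le (A : set 'rV[R]_d) (v : R) : 0 < M ->
  {ae lebesgue_row R d, forall x, f x <= M} -> measurable A ->
  (lebesgue_row R d A <= v%:E)%E -> (P (X @^-1` A) <= (M * v)%:E)%E.
Proof.
move=> M0 fM mA Av; have [mf f0 _] := fd.
have -> : P (X @^-1` A) = distribution P X A by [].
rewrite Xf//; apply: (@le_trans _ _ (\int[lebesgue_row R d]_(x in A) M%:E)%E).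
  apply: ae_ge0_le_integral => //.
  - by move=> x _; rewrite lee_fin.
  - apply/measurable_EFinP; exact: measurable_funTS.
  - by move=> x _; rewrite lee_fin ltW.
  - by apply: filterS fM => x fx _; rewrite lee_fin.
by rewrite integral_cst// EFinM lee_wpmul2l// lee_fin ltW.
Qed.

Lemma density_support0 (A : set 'rV[R]_d) : measurable A ->
  (forall x, A x -> f x = 0) -> P (X @^-1` A) = 0%E.
Proof.
move=> mA fA; have -> : P (X @^-1` A) = distribution P X A by [].
by rewrite Xf//; apply: integral0_eq => x /fA ->.
Qed.

End vertices_of_random_points.

Lemma cube_box (R : realType) d' :
  [set x : 'rV[R]_d'.+1 | forall k, `|x ord0 k| <= 1] = box 0 (fun=> 1).
Proof.
apply/seteqP; split=> x h k; have := h k.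
  by rewrite ler_norml mxE in_itv/= sub0r add0r.
by rewrite ler_norml mxE in_itv/= sub0r add0r.
Qed.

(** The resolution [2 ^ - l] is the one at which a plate has mass of order
    [M / n], and the net has about [n ^ ((d - 1) / (d + 1))] points. *)
Lemma exists_scale (R : realType) d' n : (0 < n)%N ->
  exists l, n%:R * eps R l ^+ 2 <= (2 ^ (l * d'))%:R /\
    (2 ^ (l * d'))%:R <= 2 ^+ d' * n%:R `^ (d'%:R / (d'%:R + 2)) :> R.
Proof.
move=> n0.
have ex : exists l, (n <= 2 ^ (l * (d' + 2)))%N.
  exists n; apply: ltnW; apply: (leq_trans (ltn_expl n (isT : 1 < 2)%N)).
  by rewrite leq_exp2l// leq_pmulr// addn2.
case: (ex_minnP ex) => l hl lmin; exists l; split.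
  have -> : (2 ^ (l * d'))%:R = (2 ^ (l * (d' + 2)))%:R * eps R l ^+ 2 :> R.
    rewrite mulnDr expnD natrM -mulrA (expnM 2 l 2) (natrX _ (2 ^ l)) -exprMn.
    by rewrite epsK expr1n mulr1.
  by rewrite ler_wpM2r ?sqr_ge0// ler_nat.
set t : R := n%:R `^ (d'%:R + 2)^-1.
have t0 : 0 <= t := powR_ge0 _ _.
have tn : t ^+ (d' + 2) = n%:R.
  have D0 : d'%:R + 2 != 0 :> R by rewrite gt_eqF// ltr_wpDl.
  by rewrite -powR_mulrn// -powRrM natrD mulVf// powRr1.
have td : n%:R `^ (d'%:R / (d'%:R + 2)) = t ^+ d'.
  by rewrite mulrC powRrM powR_mulrn.
have t1 : 1 <= t.
  rewrite leNgt; apply/negP => lt1; have : t ^+ (d' + 2) < 1.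
    by rewrite exprn_ilt1// addn2.
  by rewrite tn ltrn1 ltnNge n0.
rewrite td; case: l lmin {hl} => [|l] lmin.
  by rewrite mul0n expn0 -[leLHS]mulr1 ler_pM ?exprn_ege1// ler1n.
have ln : (2 ^ (l * (d' + 2)) < n)%N.
  by rewrite ltnNge; apply/negP => /lmin; rewrite ltnn.
have lt : (2 ^ l)%:R <= t.
  rewrite leNgt; apply/negP => tl.
  have : t ^+ (d' + 2) < (2 ^ l)%:R ^+ (d' + 2) by rewrite ltrXn2r// addn2.
  by rewrite tn -natrX -expnM ltr_nat ltnNge (ltnW ln).
rewrite mulSn expnD natrM natrX ler_wpM2l ?exprn_ge0// expnM natrX.
by rewrite lerXn2r// nnegrE.
Qed.

Theorem theorem3 (R : realType) (d : nat) (hd : (2 <= d)%N)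
    (q : nat) (hq : (0 < q)%N) :
  exists2 B : R, 0 < B &
    forall (n : nat) (K : set 'rV[R]_d) (f : 'rV[R]_d -> R) (M : R)
           (disp : measure_display) (Omega : measurableType disp)
           (P : probability Omega R) (X : 'I_n -> {RV P >-> 'rV[R]_d}),
      (1 <= n)%N ->
      convex_body K ->
      K `<=` unit_euclidean_ball R d ->
      probability_density f ->
      (forall x, ~ K x -> f x = 0) ->
      0 < M ->
      {ae lebesgue_row R d, forall x, f x <= M} ->
      mutually_independent X ->
      (forall i, has_density (X i) f) ->
      ('E_P[fun w => ((vertex_number (fun i => X i w))%:R ^+ q)%R] <=
        (B * (M + 1) ^+ q *
         n%:R `^ (q%:R * (d%:R - 1) / (d%:R + 1)))%:E)%E.
Proof.
case: d hd => // d'; rewrite ltnS => d'0.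
pose lc : R := ln (corr_bound d')%:R.
have c0 : (0 < corr_bound d')%N by rewrite muln_gt0 expn_gt0.
have lc0 : 0 <= lc by rewrite ln_ge0// ler1n.
have C0 : 0 <= cover_const R d' by rewrite /cover_const !mulr_ge0// ?exprn_ge0.
(* The first term comes from the number of sets in the cover, the second from
   their mass; the last one makes [L] below at least 1. *)
pose K0 : R := 4 * d'.+1%:R * lc + cover_const R d' + 1.
have dlc : 0 <= d'.+1%:R * lc by rewrite mulr_ge0.
have K1 : 1 <= K0 by rewrite /K0; lra.
have mc0 := moment_const_gt0 R hq.
exists (2 * moment_const R q * K0 ^+ q * (2 ^+ d') ^+ q).
  have K00 : 0 < K0 := lt_le_trans ltr01 K1.
  apply: mulr_gt0; last by rewrite !exprn_gt0.
  by apply: mulr_gt0; [exact: mulr_gt0|rewrite exprn_gt0].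
move=> n K f M disp Omega P X n1 _ KB fd fK M0 fM ind Xf.
have [l [nl Nl]] := exists_scale R d' n1.
set N : R := (2 ^ (l * d'))%:R in nl Nl.
have N1 : 1 <= N by rewrite ler1n expn_gt0.
have [J [A [cJ mA lA hA]]] := @cap_cover R d' l d'0.
pose p := M * (cover_const R d' * eps R l ^+ 2).
have p0 : 0 <= p.
  by apply: mulr_ge0; [exact: ltW|apply: mulr_ge0 => //; exact: sqr_ge0].
pose L := K0 * (M + 1) * N.
have MN : 0 <= M * N by rewrite mulr_ge0 ?ltW// (lt_le_trans _ N1).
have L1 : 1 <= L.
  rewrite /L -[leLHS]mulr1 ler_pM// -[leLHS]mulr1 ler_pM//; lra.
pose cube := [set x : 'rV[R]_d'.+1 | forall k, `|x ord0 k| <= 1].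
have mcube : measurable cube by rewrite /cube cube_box; exact: measurable_box.
pose bad := \big[setU/set0]_(i : 'I_n) (X i @^-1` (~` cube)).
have mout i : measurable (X i @^-1` (~` cube)).
  rewrite -[X in measurable X]setTI; apply: measurable_funP => //.
  exact: measurableC.
have mbad : measurable bad by exact: bigsetU_measurable.
have bad0 : P bad = 0%E.
  apply/eqP; rewrite eq_le measure_ge0 andbT.
  apply: le_trans (measure_bigsetU_le P _ mout) _.
  rewrite big1// => i _; apply: (density_support0 (Xf i)).
    exact: measurableC.
  move=> x xc; apply: fK => Kx; apply: xc => k.
  exact: unit_ball_coord (KB _ Kx).
have hits_le w : ~ bad w -> exists j,
    (vertex_number (fun i => X i w) <=
      #|hits (fun i => X i : Omega -> _) (A j) w|)%N.
  move=> nbad; have [i k|j hj] := hA n (fun i => X i w) n1 _.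
    apply: contrapT => h; apply: nbad; rewrite /bad -bigcup_seq.
    by exists i => /=; [rewrite mem_index_enum|move=> /(_ k)].
  by exists j; exact: vertex_number_le.
have count : #|J|%:R * (1 + p) ^+ n <= expR L.
  have h1 : #|J|%:R <= expR (4 * d'.+1%:R * lc * N).
    rewrite (_ : 4 * _ * lc * N = (2 * #|net d' l|)%:R * lc); last first.
      by rewrite card_net !natrM; ring.
    rewrite expRM_natl lnK ?posrE ?ltr0n// -natrX ler_nat.
    exact: cJ.
  have h2 : (1 + p) ^+ n <= expR (M * cover_const R d' * N).
    apply: (@le_trans _ _ (expR p ^+ n)).
      by rewrite lerXn2r ?nnegrE ?expR_ge0 ?addr_ge0// expR_ge1Dx.
    rewrite -expRM_natl ler_expR /p (_ : _ * _ = M * cover_const R d' * (n%:R * eps R l ^+ 2)).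
      by rewrite ler_wpM2l// mulr_ge0// ltW.
    by ring.
  apply: (@le_trans _ _ (expR (4 * d'.+1%:R * lc * N) * expR (M * cover_const R d' * N))).
    by rewrite ler_pM// exprn_ge0// addr_ge0.
  rewrite -expRD ler_expR /L -mulrDl ler_wpM2r//.
  have := mulr_ge0 (ltW M0) dlc; rewrite /K0; nra.
have -> : ('E_P[fun w => ((vertex_number (fun i => X i w))%:R ^+ q)%R] =
    \int[P]_w ((vertex_number (fun i => X i w))%:R ^+ q)%:E)%E by rewrite unlock.
apply: le_trans (moment_bound hq p0 L1 ind mA _ count mbad bad0 _ hits_le) _.
- by move=> j i; have := density_le fd (Xf i) M0 fM (mA j) (lA j).
- by move=> w; have := (@vertex_number_le_size R d'.+1 n (fun i => X i w)).
rewrite lee_fin /L.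
have -> : q%:R * (d'.+1%:R - 1) / (d'.+1%:R + 1) = d'%:R / (d'%:R + 2) * q%:R :> R.
  have -> : d'.+1%:R = d'%:R + 1 :> R by rewrite natr1.
  by rewrite addrK -addrA -natrD mulrAC mulrC (mulrC q%:R) mulrA.
rewrite powRrM powR_mulrn ?powR_ge0//.
set t := _ `^ _ in Nl *; move: (moment_const R q) mc0 => mc mc0.
have -> : 2 * mc * (K0 * (M + 1) * N) ^+ q = 2 * mc * K0 ^+ q * (M + 1) ^+ q * N ^+ q.
  by rewrite !exprMn !mulrA.
have -> : 2 * mc * K0 ^+ q * (2 ^+ d') ^+ q * (M + 1) ^+ q * t ^+ q =
    2 * mc * K0 ^+ q * (M + 1) ^+ q * (2 ^+ d' * t) ^+ q.
  by rewrite exprMn; ring.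
apply: ler_wpM2l.
  apply: mulr_ge0; last by rewrite exprn_ge0// addr_ge0// ltW.
  apply: mulr_ge0; last by rewrite exprn_ge0// (le_trans _ K1).
  by rewrite mulr_ge0// ltW.
by rewrite lerXn2r// nnegrE// (le_trans _ Nl).
Qed.
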